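(* For $n\ge4$ let $h_n=\pi/n$ and let $\tau_n\in(0,1/4)$. Then for every $n\ge 4$ there exists a set of distinct perturbed Chebyshev--Lobatto points $$x_j=\cos\theta_j,\qquad j=0,\ldots,n,\qquad \theta_0=0,\quad \theta_n=\pi,$$ with $$\max_{0\le j\le n}|\theta_j-jh_n|\le\frac{h_n}{2},$$ such that its Lebesgue constant $\Lambda_n$ satisfies $$\Lambda_n\ge\frac{1}{\pi n\tau_n}.$$ Consequently, by taking for example $\tau_n=\frac{1}{n(\log n)^2}$, one obtains a sequence of angular perturbations of size $O(1/n)$ (that is, with $\max_{0\le j\le n}|\theta_j-jh_n|\le h_n/2$) for which $$\Lambda_n\ge\frac1\pi(\log n)^2 ,$$ so that angular perturbations of size $O(1/n)$ can lead to Lebesgue constants growing faster than $\log n$.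
   Context: $\log$ denotes the natural logarithm. The (unperturbed) Chebyshev--Lobatto points are $\cos(j\pi/n)$, $j=0,\ldots,n$; perturbed Chebyshev--Lobatto points are points $x_j=\cos\theta_j$ with $\theta_j=j\pi/n+\varepsilon_j$, $\varepsilon_j\in\mathbb{R}$, and $\theta_0=0$, $\theta_n=\pi$. For a set of distinct nodes $\{x_0,\ldots,x_n\}\subset[-1,1]$, the Lagrange basis polynomials are $\ell_j(x)=\prod_{k\ne j}\frac{x-x_k}{x_j-x_k}$, and the Lebesgue constant of the node set is $\Lambda_n=\max_{x\in[-1,1]}\sum_{j=0}^n|\ell_j(x)|$. *)

(* Defs.v *)
From HB Require Import structures.
From mathcomp Require Import all_boot all_order all_algebra.
From mathcomp Require Import all_classical all_reals all_analysis.

Set Implicit Arguments.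
Unset Strict Implicit.
Unset Printing Implicit Defensive.

Import Order.TTheory GRing.Theory Num.Theory.
Import numFieldNormedType.Exports.

Local Open Scope classical_set_scope.
Local Open Scope ring_scope.

Definition lagrange_basis (R : realType) (n : nat) (x : 'I_n.+1 -> R)
    (j : 'I_n.+1) (t : R) : R :=
  \prod_(k < n.+1 | k != j) ((t - x k) / (x j - x k)).

Definition lebesgue_function (R : realType) (n : nat) (x : 'I_n.+1 -> R)
    (t : R) : R :=
  \sum_(j < n.+1) `|lagrange_basis x j t|.

(* The supremum is attained, see [lebesgue_constant_max]. *)
Definition lebesgue_constant (R : realType) (n : nat) (x : 'I_n.+1 -> R) : R :=
  sup [set lebesgue_function x t | t in `[-1, 1]].

Definition lobatto_step (R : realType) (n : nat) : R := pi / n%:R.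

(* The neutral element 0 does not affect the maximum, since the family is
   nonempty and its terms are nonnegative. *)
Definition max_perturbation (R : realType) (n : nat)
    (theta : 'I_n.+1 -> R) : R :=
  \big[Num.max/0]_(j < n.+1) `|theta j - j%:R * lobatto_step R n|.

Definition nodes (R : realType) (n : nat) (theta : 'I_n.+1 -> R)
    (j : 'I_n.+1) : R := cos (theta j).

(* The perturbations are eps_j = theta_j - j * lobatto_step n, which range over
   all reals apart from the endpoint conditions; the points, not only the
   angles, are required to be distinct. *)
Definition perturbed_lobatto (R : realType) (n : nat)
    (theta : 'I_n.+1 -> R) : Prop :=
  [/\ theta ord0 = 0, theta ord_max = pi & injective (nodes theta)].

Lemma continuous_lebesgue_function (R : realType) (n : nat)
    (x : 'I_n.+1 -> R) : continuous (lebesgue_function x).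
Proof.
move=> t; rewrite /lebesgue_function.
apply: (@cvg_big R _ +%R 0 xpredT _ R (nbhs t)) => [|j _]; first exact: add_continuous.
apply: cvg_norm.
apply: (@cvg_big R _ *%R 1 (fun k => k != j) _ R (nbhs t)) => [|k _]; first exact: mul_continuous.
by apply: cvgM; [apply: cvgB; [exact: cvg_id|exact: cvg_cst]|exact: cvg_cst].
Qed.

Lemma lebesgue_constant_max (R : realType) (n : nat) (x : 'I_n.+1 -> R) :
  (exists2 t, t \in `[-1, 1] & lebesgue_function x t = lebesgue_constant x) /\
  (forall t, t \in `[-1, 1] -> lebesgue_function x t <= lebesgue_constant x).
Proof.
have le11 : -1 <= 1 :> R by rewrite (le_trans (lerN10 R)) ?ler01.
have [c cI cmax] := EVT_max le11
  (continuous_subspaceT (@continuous_lebesgue_function R n x)).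
suff -> : lebesgue_constant x = lebesgue_function x c by split => //; exists c.
have ubc : ubound [set lebesgue_function x t | t in `[-1, 1]]
    (lebesgue_function x c) by move=> _ [t tI <-]; exact: cmax.
apply/eqP; rewrite eq_le; apply/andP; split.
  by apply: ge_sup => //; exists (lebesgue_function x c), c.
by apply: ub_le_sup; [exists (lebesgue_function x c)|exists c].
Qed.

(* Main.v *)
Require Import Defs.
From HB Require Import structures.
From mathcomp Require Import all_boot all_order all_algebra.
From mathcomp Require Import all_classical all_reals all_analysis.
From mathcomp Require Import lra.

Set Implicit Arguments.
Unset Strict Implicit.
Unset Printing Implicit Defensive.

Import Order.TTheory GRing.Theory Num.Theory.
Import numFieldNormedType.Exports.

Local Open Scope classical_set_scope.
Local Open Scope ring_scope.

(** The angles 2h and h may be moved to 3h/2 and 3h/2 - s for any small s > 0,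
    which makes two nodes as close as we please while h/2 stays away from
    all angles.  At t = cos (h/2) the Lagrange basis polynomial of the first of
    these two nodes is then at least a positive constant, independent of s,
    divided by the distance of the two nodes, so the Lebesgue constant exceeds
    any prescribed bound. *)

(** The factor of index [j] is split off because it alone carries the small denominator [x i - x j].
    In every other factor the numerator is at least [c] and the denominator at most 2, both nodes
    lying in [-1, 1]. *)
Lemma lagrange_basis_ge (R : realType) (n : nat) (x : 'I_n.+1 -> R)
    (i j : 'I_n.+1) (t c : R) :
  j != i -> injective x -> (forall k, -1 <= x k <= 1) ->
  0 <= c -> (forall k, c <= `|t - x k|) ->
  c / `|x i - x j| * (c / 2) ^+ #|[pred k | (k != i) && (k != j)]|
    <= `|lagrange_basis x i t|.
Proof.
move=> ji xinj x1 c0 tx.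
rewrite /lagrange_basis (bigD1 j) //= normrM normf_div normr_prod -prodr_const.
have xij k : k != i -> 0 < `|x i - x k|.
  by move=> ki; rewrite normr_gt0 subr_eq0 (inj_eq xinj) eq_sym.
apply: ler_pM; first by rewrite divr_ge0.
- by apply: prodr_ge0 => k _; rewrite divr_ge0.
- by apply: ler_wpM2r (tx j); rewrite invr_ge0.
apply: ler_prod => k /andP[ki _]; rewrite divr_ge0 //= normf_div.
rewrite ler_pM ?invr_ge0 // lef_pV2 ?posrE ?xij //.
by have := x1 i; have := x1 k; rewrite ler_norml; lra.
Qed.

(** Indexed by [nat] rather than ['I_n.+1], so that monotonicity reduces to consecutive indices. *)
Definition pinched_angle (R : realType) (n : nat) (s : R) (k : nat) : R :=
  if k == 1%N then 3 / 2 * lobatto_step R n - s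
  else if k == 2%N then 3 / 2 * lobatto_step R n
  else k%:R * lobatto_step R n.

Section PinchedAngle.
Variables (R : realType) (n : nat) (s : R).
Hypotheses (n4 : (4 <= n)%N) (s0 : 0 < s) (sh : s <= lobatto_step R n / 2).

Local Notation h := (lobatto_step R n).
Let theta (k : nat) := pinched_angle n s k.

Lemma lobatto_step_gt0 : 0 < lobatto_step R n.
Proof. by rewrite divr_gt0 ?pi_gt0 // ltr0n (leq_trans _ n4). Qed.

Lemma pinched_angle_homo : {homo theta : i j / (i < j)%N >-> i < j}.
Proof.
have h0 := lobatto_step_gt0; have [s_gt0 s_le] := (s0, sh).
apply: homo_ltn => [x y z|k]; first exact: lt_trans.
(* The first three gaps, the only ones touching a moved angle, are 3h/2 - s, s and 3h/2. *)
move: k => [|[|[|k]]]; rewrite /theta /pinched_angle /= ?mul0r; [lra|lra|lra|].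
by rewrite ltr_pM2r // ltr_nat.
Qed.

Lemma pinched_angle_inj : injective theta.
Proof.
move=> i j /eqP; apply: contraTeq; rewrite neq_ltn.
by case/orP => /pinched_angle_homo /lt_eqF e; rewrite ?e // eq_sym e.
Qed.

Lemma pinched_angle0 : theta 0 = 0.
Proof. by rewrite /theta /pinched_angle /= mul0r. Qed.

Lemma pinched_anglen : theta n = pi.
Proof.
have n0 : n%:R != 0 :> R by rewrite pnatr_eq0 -lt0n (leq_trans _ n4).
rewrite /theta /pinched_angle; move: n n4 n0 => [|[|[|m]]] //= _ m0.
by rewrite mulrC divfK.
Qed.

Lemma pinched_angle_itv k : (k <= n)%N -> theta k \in `[0, pi].
Proof.
have mono := ltW_homo pinched_angle_homo => kn.
by rewrite in_itv /= -pinched_angle0 -pinched_anglen !mono.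
Qed.

Lemma pinched_angle_perturbed :
  perturbed_lobatto (fun j : 'I_n.+1 => theta j).
Proof.
split; [exact: pinched_angle0|exact: pinched_anglen|move=> i j /cos_inj].
by rewrite !pinched_angle_itv -1?ltnS // => /(_ isT isT)/pinched_angle_inj/val_inj.
Qed.

Lemma pinched_angle_dist :
  max_perturbation (fun j : 'I_n.+1 => theta j) <= lobatto_step R n / 2.
Proof.
have h0 := lobatto_step_gt0; have [s_gt0 s_le] := (s0, sh).
apply: bigmax_le => [|[k kn] _ /=]; first by lra.
rewrite /theta /pinched_angle ler_norml.
by move: k kn => [|[|[|k]]] kn //=; rewrite ?subrr; lra.
Qed.

(** As s is at most h/2, no angle lies strictly between 0 and h, and cos decreases on [0, pi]. The
    bound does not involve s, so s may be chosen after it. *)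
Lemma pinched_angle_far k : (k <= n)%N ->
  Num.min (1 - cos (h / 2)) (cos (h / 2) - cos h)
    <= `|cos (h / 2) - cos (theta k)|.
Proof.
have h0 := lobatto_step_gt0; have [s_gt0 s_le] := (s0, sh).
have hpi : h < pi.
  rewrite -pinched_anglen; apply: (@le_lt_trans _ _ (theta 1)).
    by rewrite /theta /pinched_angle /=; lra.
  by apply: pinched_angle_homo; rewrite (leq_trans _ n4).
case: k => [|k] kn.
  by rewrite pinched_angle0 cos0 distrC ge_min ler_norm.
rewrite ge_min; apply/orP; right; apply: le_trans (ler_norm _).
rewrite lerD2l lerN2.
have hk : h <= theta k.+1.
  apply: (@le_trans _ _ (theta 1)).
    by rewrite /theta /pinched_angle /=; lra.
  exact: (ltW_homo pinched_angle_homo).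
rewrite le_eqVlt; have [->|hne] := eqVneq h (theta k.+1); first by rewrite eqxx.
rewrite ltr_cos ?pinched_angle_itv //; first by rewrite lt_neqAle hne hk orbT.
by rewrite in_itv /=; lra.
Qed.

End PinchedAngle.

(** Both lower bounds of the theorem are instances, with [M] equal to 1/(pi n tau_n) or to (log
    n)^2/pi. *)
Lemma lebesgue_constant_unbounded (R : realType) (n : nat) (M : R) :
  (4 <= n)%N -> exists theta : 'I_n.+1 -> R,
    [/\ perturbed_lobatto theta, max_perturbation theta <= lobatto_step R n / 2
      & M <= lebesgue_constant (nodes theta)].
Proof.
move=> n4; set h := lobatto_step R n; have h0 : 0 < h := lobatto_step_gt0 R n4.
have hpi : h < pi.
  by rewrite ltr_pdivrMr ?ltr_pMr ?pi_gt0 ?ltr1n ?ltr0n // (leq_trans _ n4).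
pose i : 'I_n.+1 := inord 1; pose j : 'I_n.+1 := inord 2.
have iE : i = 1%N :> nat by rewrite inordK // ltnS (leq_trans _ n4).
have jE : j = 2%N :> nat by rewrite inordK // ltnS (leq_trans _ n4).
have ji : j != i by rewrite -val_eqE /= iE jE.
pose c := Num.min (1 - cos (h / 2)) (cos (h / 2) - cos h).
have c0 : 0 < c.
  by rewrite lt_min -[X in X - _]cos0 !subr_gt0 !ltr_cos ?in_itv /=; lra.
pose K := c * (c / 2) ^+ #|[pred k | (k != i) && (k != j)]|.
have K0 : 0 < K by rewrite mulr_gt0 // exprn_gt0 // divr_gt0.
(* The basis polynomial is at least [K] over the distance of the two close nodes; a distance below
   [e] makes this exceed 1 + |M|. The summand 1 keeps the denominator positive when [M] is 0. *)
pose e := K / (1 + `|M|).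
have e0 : 0 < e by rewrite divr_gt0 // ltr_pwDl.
have [d /= d0 cosd] : exists2 d : R, 0 < d &
    forall y, `|3 / 2 * h - y| < d -> `|cos (3 / 2 * h) - cos y| < e.
  have /cvgr_dist_lt/(_ _ e0)/nbhs_ballP[d d0 dP] :=
    @continuous_cos R (3 / 2 * h).
  by exists d => // y yd; exact: dP.
(* Half of [d] gives the strict inequality needed for continuity of cos at 3h/2; [h / 2] is the
   bound required of pinched angles. *)
pose s := Num.min (d / 2) (h / 2).
have s0 : 0 < s by rewrite lt_min; lra.
have sh : s <= h / 2 by rewrite ge_min lexx orbT.
have sd : s < d by rewrite gt_min; apply/orP; left; lra.
pose theta (k : 'I_n.+1) := pinched_angle n s k.
have pert : perturbed_lobatto theta by exact: pinched_angle_perturbed.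
exists theta; split => //; first exact: pinched_angle_dist.
have x1 (y : R) : -1 <= cos y <= 1 by rewrite cos_geN1 cos_le1.
have tI : cos (h / 2) \in `[-1, 1] by rewrite in_itv /= x1.
apply: le_trans ((lebesgue_constant_max (nodes theta)).2 _ tI).
apply: (@le_trans _ _ `|lagrange_basis (nodes theta) i (cos (h / 2))|); last first.
  by rewrite /lebesgue_function (bigD1 i) //= lerDl sumr_ge0.
have xinj : injective (nodes theta) by case: pert.
apply: le_trans (lagrange_basis_ge ji xinj (fun k => x1 _) (ltW c0) _); last first.
  by move=> k; apply: pinched_angle_far => //; rewrite -ltnS.
have g0 : 0 < `|nodes theta i - nodes theta j|.
  by rewrite normr_gt0 subr_eq0 (inj_eq xinj) eq_sym.
have ge : `|nodes theta i - nodes theta j| < e.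
  rewrite distrC /nodes /theta iE jE; apply: cosd; rewrite /pinched_angle /= -/h.
  by rewrite opprB addrC subrK gtr0_norm.
have KE : K = (1 + `|M|) * e by rewrite mulrC divfK // gt_eqF // ltr_pwDl.
rewrite mulrAC -/K ler_pdivlMr // KE.
apply: le_trans (ler_wpM2r (ltW g0) (ler_norm M)) _.
by rewrite ler_pM // ?ltW // ltrDr.
Qed.

(** The inequality 1 + x < exp x at x = -1/2 gives exp(1/2) < 2; squaring yields e < 4. *)
Lemma ln4_gt1 (R : realType) : 1 < ln 4 :> R.
Proof.
have e2 : expR (2^-1) < 2 :> R.
  have nz : - 2^-1 != 0 :> R by rewrite oppr_eq0 invr_eq0 pnatr_eq0.
  have := expR_gt1Dx nz; rewrite expRN => lb.
  have : 2^-1 < (expR 2^-1)^-1 :> R by apply: le_lt_trans lb; lra.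
  by rewrite ltf_pV2 ?posrE ?expR_gt0.
rewrite -[ltLHS]expRK ltr_ln ?posrE ?expR_gt0 //.
rewrite [X in expR X](_ : _ = 2^-1 + 2^-1); last by lra.
rewrite expRD [ltRHS](_ : _ = 2 * 2); last by lra.
by rewrite ltr_pM ?expR_ge0.
Qed.

Lemma ln_nat_gt1 (R : realType) (n : nat) : (4 <= n)%N -> 1 < ln n%:R :> R.
Proof.
move=> n4; apply: lt_le_trans (ln4_gt1 R) _.
by rewrite ler_ln ?posrE ?ltr0n ?ler_nat // (leq_trans _ n4).
Qed.

Theorem proposition3p1 (R : realType) :
  (forall tau : nat -> R,
    (forall n : nat, (4 <= n)%N -> 0 < tau n < 1 / 4) ->
    forall n : nat, (4 <= n)%N ->
    exists theta : 'I_n.+1 -> R,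
      [/\ perturbed_lobatto theta,
          max_perturbation theta <= lobatto_step R n / 2 &
          lebesgue_constant (nodes theta) >= 1 / (pi * n%:R * tau n)])
  /\
  (forall n : nat, (4 <= n)%N -> 0 < 1 / (n%:R * ln (n%:R : R) ^+ 2) < 1 / 4)
  /\
  (exists theta : forall n : nat, 'I_n.+1 -> R,
    (forall n : nat, (4 <= n)%N ->
      [/\ perturbed_lobatto (theta n),
          max_perturbation (theta n) <= lobatto_step R n / 2 &
          lebesgue_constant (nodes (theta n)) >= 1 / pi * ln n%:R ^+ 2]) /\
    (lebesgue_constant (nodes (theta n)) / ln (n%:R : R) @[n --> \oo] --> +oo)).
Proof.
split=> [tau _ n n4|]; first exact: lebesgue_constant_unbounded.
split=> [n n4|].
  have l2 : 1 < ln n%:R ^+ 2 :> R by rewrite exprn_egt1 // ln_nat_gt1.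
  have n4R : 4 <= n%:R :> R by rewrite ler_nat.
  have nl : 4 < n%:R * ln n%:R ^+ 2 :> R by nra.
  have pos : 0 < n%:R * ln n%:R ^+ 2 :> R by lra.
  by rewrite !div1r invr_gt0 pos ltf_pV2 ?posrE.
have ex_theta : forall n, exists th : 'I_n.+1 -> R, (4 <= n)%N ->
  [/\ perturbed_lobatto th, max_perturbation th <= lobatto_step R n / 2 &
      lebesgue_constant (nodes th) >= 1 / pi * ln n%:R ^+ 2].
  (* Below 4 nothing is claimed, and the zero family is a mere default. *)
  move=> n; have [n4|n4] := leqP 4 n; last by exists (fun=> 0).
  have [th thP] := lebesgue_constant_unbounded (1 / pi * ln n%:R ^+ 2 : R) n4.
  by exists th.
pose theta n := sval (cid (ex_theta n)).
have thetaP n := svalP (cid (ex_theta n)) : (4 <= n)%N -> _.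
exists theta; split => //.
apply/cvgryPge => A; near=> n.
have n4 : (4 <= n)%N by near: n; exact: nbhs_infty_ge.
(* The quotient is at least (log n)/pi, so it exceeds [A] once n is at least exp(pi A). *)
have lnA : pi * A <= ln n%:R.
  rewrite -[leLHS]expRK ler_ln ?posrE ?expR_gt0 //.
    by near: n; exact: nbhs_infty_ger.
  by rewrite ltr0n (leq_trans _ n4).
have ln0 : 0 < ln n%:R :> R := lt_trans ltr01 (ln_nat_gt1 R n4).
have [_ _] := thetaP n n4; rewrite ler_pdivlMr //; apply: le_trans.
by rewrite expr2 mulrA ler_pM2r // div1r mulrC ler_pdivlMr ?pi_gt0 // mulrC.
Unshelve. all: by end_near. Qed.
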